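(* Let $X$ be an $S$-concave space with $S\ge1$, and let $0<\delta\le1/64$ satisfy $4(S-1)\sqrt\delta\le1$. Let $(x;p,y,z)$ be four distinct points in $X$ satisfying $\tilde\angle pxy\ge\pi-\delta$, $|xz|\le|xy|\le|px|$, $\delta_S(|xz|;|xy|)\le\delta$ and $\delta_S(|xy|;|px|)\le\delta$. Then $$\tilde\angle pxy+\tilde\angle pxz+\tilde\angle yxz\le2\pi+\arccos\left(1-4(S-1)\sqrt\delta\right)+14\delta+2\sqrt\delta .$$ In particular, given any $\varepsilon\in(0,\pi]$, there exists $\bar\delta=\bar\delta(\varepsilon,S)>0$ (depending only on $\varepsilon$ and $S$) such that $X$ satisfies the $(\varepsilon,\delta)$-weak quadruple condition for all $\delta\in(0,\bar\delta]$.
   Context: $(X,\mathsf d)$ is a complete, separable geodesic space and $|xy|=\mathsf d(x,y)$. A constant-speed geodesic is a curve $\gamma:[0,1]\to X$ with $|\gamma(t)\gamma(s)|=|t-s|\,|\gamma(0)\gamma(1)|$; $X$ is geodesic if any two points are joined by one. $S$-concave ($S\ge1$): for every $p\in X$, every constant-speed geodesic $\gamma:[0,1]\to X$ and $t\in[0,1]$, $|p\gamma(t)|^2\ge(1-t)|p\gamma(0)|^2+t|p\gamma(1)|^2-St(1-t)|\gamma(0)\gamma(1)|^2$. Comparison angle: for $y,z\ne x$, $\tilde\angle yxz=\arccos\frac{|xy|^2+|xz|^2-|yz|^2}{2|xy||xz|}$. Error function: $\delta_S(s;t)=\arccos\left(1-\frac{(S-1)s}{2t}\right)$ for $s,t>0$;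 an inequality involving $\delta_S(s;t)$ includes the requirement that it is defined. $(\varepsilon,\delta)$-weak quadruple condition ($\varepsilon\in[0,\pi]$, $\delta\in(0,\pi]$): for any four distinct points $(x;p,y,z)$ in $X$ with $\tilde\angle pxy\ge\pi-\delta$, $|xz|\le|xy|\le|px|$, $\delta_S(|xz|;|xy|)\le\delta$ and $\delta_S(|xy|;|px|)\le\delta$, one has $\tilde\angle pxy+\tilde\angle pxz+\tilde\angle yxz\le2\pi+\varepsilon$. *)

(* Defs.v *)
From mathcomp Require Import all_boot all_order all_algebra.
From mathcomp Require Import all_classical all_reals all_analysis.
Set Implicit Arguments.
Unset Strict Implicit.
Unset Printing Implicit Defensive.
Import Order.TTheory GRing.Theory Num.Theory.
Local Open Scope classical_set_scope.
Local Open Scope ring_scope.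

Section MetricNotions.
Variables (R : realType) (X : metricType R).

Definition complete_space : Prop :=
  forall u : nat -> X, cauchy (u @ \oo) -> exists l : X, u @ \oo --> l.

Definition separable_space : Prop :=
  exists D : set X, countable D /\ dense D.

(* A curve on [0,1] is a function on R of which only the values on [0,1]
   matter. *)
Definition constant_speed_geodesic (g : R -> X) : Prop :=
  forall t s : R, 0 <= t <= 1 -> 0 <= s <= 1 ->
    mdist (g t) (g s) = `|t - s| * mdist (g 0) (g 1).

Definition geodesic_space : Prop :=
  forall a b : X, exists g : R -> X,
    [/\ constant_speed_geodesic g, g 0 = a & g 1 = b].

Definition S_concave (S : R) : Prop :=
  forall (p : X) (g : R -> X) (t : R),
    constant_speed_geodesic g -> 0 <= t <= 1 ->
    (1 - t) * mdist p (g 0) ^+ 2 + t * mdist p (g 1) ^+ 2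
      - S * t * (1 - t) * mdist (g 0) (g 1) ^+ 2
    <= mdist p (g t) ^+ 2.

Definition S_concave_space (S : R) : Prop :=
  [/\ complete_space, separable_space, geodesic_space & S_concave S].

(* The angle at the middle argument x, meaningful for y, z != x (the triangle
   inequality then puts the argument of acos in [-1, 1]). *)
Definition cmp_angle (y x z : X) : R :=
  acos ((mdist x y ^+ 2 + mdist x z ^+ 2 - mdist y z ^+ 2)
        / (2 * mdist x y * mdist x z)).

End MetricNotions.

Definition err_arg (R : realType) (S s t : R) : R :=
  1 - (S - 1) * s / (2 * t).

Definition err (R : realType) (S s t : R) : R := acos (err_arg S s t).

(* The inequality err S s t <= d, including the requirement that err S s t be
   defined: acos is total in the library, hence the explicit domain. *)
Definition err_le (R : realType) (S s t d : R) : Prop :=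
  [/\ 0 < s, 0 < t, -1 <= err_arg S s t <= 1 & err S s t <= d].

Definition quadruple_hyp (R : realType) (X : metricType R) (S delta : R)
    (x p y z : X) : Prop :=
  [/\ uniq [:: x; p; y; z],
      pi - delta <= cmp_angle p x y,
      mdist x z <= mdist x y <= mdist p x,
      err_le S (mdist x z) (mdist x y) delta
    & err_le S (mdist x y) (mdist p x) delta].

Definition weak_quadruple_condition (R : realType) (X : metricType R)
    (S eps delta : R) : Prop :=
  [/\ 0 <= eps <= pi, 0 < delta <= pi
    & forall x p y z : X, quadruple_hyp S delta x p y z ->
        cmp_angle p x y + cmp_angle p x z + cmp_angle y x z <= 2 * pi + eps].

(* Main.v *)
Require Import Defs.
From mathcomp Require Import all_boot all_order all_algebra.
From mathcomp Require Import all_classical all_reals all_analysis.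
From mathcomp Require Import ring lra.
Import Order.TTheory GRing.Theory Num.Theory.
Import numFieldNormedType.Exports.
Local Open Scope classical_set_scope.
Local Open Scope ring_scope.

(** Write a = |px|, b = |xy|, c = |xz| and d for the square root of delta, and
let g be a geodesic from x to z. S-concavity for an observer o different from x
makes (|ox|^2 - |o g(t)|^2) / t + S t c^2 nondecreasing in t, so |o g| has a
one-sided derivative at 0; call it -c times B for o = p and -c times C for
o = y. Monotonicity between t = 0 and t = 1 compares these cosines with the
comparison angles: cos (~pxz) >= B - (S - 1) c / 2a and
cos (~yxz) >= C - (S - 1) c / 2b. The hypotheses on the error function bound
both errors by 1 - cos delta, hence the angles arccos B and arccos C are at
least ~pxz - delta and ~yxz - delta ([first_variation_exists],
[le_angle_of_cos]). It remains to bound arccos B + arccos C.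

The difficulty is that S-concavity is only precise for observers that are far
from the geodesic compared with its length, so z cannot be used to observe the
path from p through x to y. Instead an auxiliary observer q is placed near x,
at a distance well above that of the points of g it observes. Fix a
tiny t, let r = t c, let m be the midpoint of the piece of g from x to g(t),
and let q be the point at distance L = r / d from m on a geodesic from m to y.

- Since ~pxy is almost pi and b is small compared with a (as measured by S - 1),
  p observing that geodesic gives |pq| >= |pm| + L (1 - d^4 - o(1)). Therefore
  |qx| >= |pq| - a >= L - (r / 2) B up to small errors.
- Since q lies between m and y, |q g(t)| >= |y g(t)| - |ym| + L, that is
  |q g(t)| >= L - (r / 2) C up to small errors: t is so small that |y g|
  decreases from m to g(t) as much as it does from x to m, namely by (r / 2) C.

Feeding both bounds into S-concavity for q observing the piece from x to g(t),
whose midpoint is at distance L from q, yields ([first_variation_sum])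

  - (B + C) <= (4/5) d^2 + (d / 2) (S - (B^2 + C^2) / 2).

When B and C are nearly opposite, 1 - (B^2 + C^2) / 2 is nearly the squared sine
of both angles. That is what turns this estimate of cosines into one of angles
that stays good near 0 and pi ([angle_sum_of_cos_sum]):

  arccos B + arccos C <= pi + arccos (1 - 4 (S - 1) d) + 2 d.

Together with ~pxy <= pi this is the announced bound, with 2 delta in place of
14 delta. The weak quadruple condition follows since the error terms tend to 0
with delta. *)

(** * Trigonometric estimates *)

Section Trigonometry.
Context {R : realType}.
Implicit Types t a b d : R.

Lemma ler_cos a b : 0 <= a -> a <= b -> b <= pi -> cos b <= cos a.
Proof.
move=> a0; rewrite le_eqVlt => /predU1P[-> //|ab] bpi; rewrite ltW //.
by rewrite ltr_cos // in_itv /=; lra.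
Qed.

Lemma sin_mvt t : 0 <= t -> exists2 u, 0 <= u <= t & sin t = cos u * t.
Proof.
move=> t0.
have /= [] := @MVT_segment R (@sin R) (@cos R) 0 t t0.
- exact/continuous_subspaceT/continuous_sin.
- by move=> u; rewrite in_itv /= sin0 !subr0 => ut E; exists u.
Qed.

Lemma sin_le t : 0 <= t -> sin t <= t.
Proof.
by move=> t0; have [u _ ->] := sin_mvt t t0; rewrite ler_piMl // cos_le1.
Qed.

Lemma cos_half_angle t : cos t = 1 - 2 * sin (t / 2) ^+ 2.
Proof.
have -> : cos t = cos ((t / 2) *+ 2) by congr cos; field.
by rewrite cos_mulr2n sin2cos2; ring.
Qed.

Lemma cos_quadratic_ge t : 0 <= t <= pi -> 1 - t ^+ 2 / 2 <= cos t.
Proof.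
move=> /andP[t0 tpi]; rewrite cos_half_angle.
have := @sin_le (t / 2) ltac:(lra).
have : 0 <= sin (t / 2) by apply: sin_ge0_pi; lra.
move: (sin _) => s; nra.
Qed.

Lemma sin_cubic_ge t : 0 <= t <= pi -> t * (1 - t ^+ 2 / 2) <= sin t.
Proof.
move=> /andP[t0 tpi]; have [u /andP[u0 ut] ->] := sin_mvt t t0.
rewrite mulrC ler_wpM2r //.
apply: le_trans (ler_cos u t u0 ut tpi).
by apply: cos_quadratic_ge; lra.
Qed.

(** The function 1 - cos is the worst modulus of continuity of arccos: a drop
of 1 - cos d in the cosine moves the angle most when it starts at angle 0. *)
Lemma le_angle_of_cos a b d : 0 <= a <= pi -> 0 <= b <= pi -> 0 <= d <= pi ->
  cos b <= cos a + (1 - cos d) -> a <= b + d.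
Proof.
move=> ha hb hd h; rewrite leNgt; apply/negP => lt.
(* If a > b + d, then cos b + cos d < 1 + cos (b + d). In terms of the half
   sum s and half difference r of b and d this reads cos r < cos s, although
   |r| <= s. *)
have c1 : cos a < cos (b + d) by rewrite ltr_cos // in_itv /=; lra.
pose s := (b + d) / 2; pose r := (b - d) / 2.
have Eb : cos b = cos (s + r) by congr cos; rewrite /s /r; field.
have Ed : cos d = cos (s - r) by congr cos; rewrite /s /r; field.
have Es : cos (b + d) = 2 * cos s ^+ 2 - 1.
  have -> : b + d = s *+ 2 by rewrite /s; field.
  by rewrite cos_mulr2n; ring.
have s0 : 0 <= cos s by apply: cos_ge0_pihalf; rewrite /s; lra.
have sr : cos s <= cos r.
  rewrite -(cos_norm r); apply: ler_cos => //; rewrite /s /r; last lra.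
  by rewrite ler_norml; lra.
rewrite Eb Ed Es cosD cosB in h c1 *.
move: h c1 s0 sr; move: (cos s) (cos r) => x y; nra.
Qed.

(** With b + c = pi + 2 p and b - c = 2 s - pi, the sum of the cosines is
-2 (sin p) (sin s), and 1 - (cos^2 b + cos^2 c) / 2 is at most
sin^2 p + sin^2 s. As sin s is between sin p and 1, the assumed inequality
can be divided by sin s and becomes an upper bound for sin p in terms of d and
of the square root of (S - 1) d. The contradiction only uses that 2 p exceeds
both 2 d and the arccosine. *)
Lemma angle_sum_of_cos_sum (S d b c : R) : 1 <= S -> 0 < d <= 1 / 8 ->
  4 * (S - 1) * d <= 1 -> 0 <= b <= pi -> 0 <= c <= pi ->
  - (cos b + cos c) <=
    4 / 5 * d ^+ 2 + d / 2 * (S - (cos b ^+ 2 + cos c ^+ 2) / 2) ->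
  b + c <= pi + acos (1 - 4 * (S - 1) * d) + 2 * d.
Proof.
move=> hS hd hSd hb hc; set A := acos _ => h.
have nn : 0 <= (S - 1) * d by apply: mulr_ge0; lra.
have ran : -1 <= 1 - 4 * (S - 1) * d <= 1 by rewrite -mulrA; lra.
have A0 : 0 <= A by exact: acos_ge0.
have cosA : cos A = 1 - 4 * (S - 1) * d by rewrite acosK // in_itv.
have pi2 := @pi_ge2 R.
rewrite leNgt; apply/negP => lt.
pose p := (b + c - pi) / 2; pose s := (b + pi - c) / 2.
have Eb : cos b = cos s * cos p - sin s * sin p.
  by rewrite -cosD; congr cos; rewrite /s /p; field.
have Ec : cos c = - (cos s * cos p + sin s * sin p).
  rewrite -cosB -cosDpi -(cosN c) -(cosD2pi (- c)).
  by congr cos; rewrite /s /p; field.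
have monosin u v : 0 <= u -> u <= v -> v <= pi / 2 -> sin u <= sin v.
  move=> u0; rewrite le_eqVlt => /predU1P[-> //|uv] vpi; rewrite ltW //.
  by rewrite ltr_sin // in_itv /=; lra.
have ppi : p <= pi / 2 by rewrite /p; lra.
have xA : sin (A / 2) <= sin p by apply: monosin; rewrite /p; lra.
have xd : sin d <= sin p by apply: monosin; rewrite /p; lra.
have sA : sin (A / 2) ^+ 2 = 2 * (S - 1) * d.
  by move: (cos_half_angle A); rewrite cosA; lra.
have sA0 : 0 <= sin (A / 2).
  by apply: sin_ge0_pi; have := @acos_lepi _ _ ran; rewrite -/A; lra.
have sd : 127 / 128 * d <= sin d.
  apply: le_trans (sin_cubic_ge d _); last lra.
  by case/andP: hd => d0 d8; nra.
have yx : sin p <= sin s.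
  have -> : s = b / 2 + (pi - c) / 2 by rewrite /s; field.
  have -> : p = b / 2 - (pi - c) / 2 by rewrite /p; field.
  rewrite sinB sinD.
  have : 0 <= cos (b / 2) * sin ((pi - c) / 2).
    by rewrite mulr_ge0 //; [apply: cos_ge0_pihalf|apply: sin_ge0_pi]; lra.
  by lra.
have y1 := @sin_le1 R s.
have sum2 : (cos b ^+ 2 + cos c ^+ 2) / 2
    = 1 - sin p ^+ 2 - sin s ^+ 2 + 2 * sin p ^+ 2 * sin s ^+ 2.
  rewrite Eb Ec; move: (cos2sin2 p) (cos2sin2 s) => ep es.
  transitivity (cos s ^+ 2 * cos p ^+ 2 + sin s ^+ 2 * sin p ^+ 2).
    by field.
  by rewrite ep es; ring.
have sum1 : - (cos b + cos c) = 2 * sin p * sin s by rewrite Eb Ec; ring.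
rewrite sum1 sum2 in h; case/andP: hd => d0 d8.
move: (sin p) (sin s) (sin (A / 2)) xA xd sA sA0 sd yx y1 h
  => x y w xA xd wE w0 sd yx y1 h.
have x0 : 0 < x by nra.
have xx : x ^+ 2 <= x * y by rewrite expr2 ler_wpM2l // ltW.
(* Each term on the right of the assumed inequality is a small multiple of
   x * y; the multiples 21/25, 1/4, 1/16 and 3/5 add up to less than 2. *)
have h1 : 4 / 5 * d ^+ 2 <= 21 / 25 * (x * y).
  by apply: le_trans (_ : 21 / 25 * x ^+ 2 <= _); [nra|lra].
have h2 : d / 2 * (S - 1) <= 1 / 4 * (x * y).
  have : w ^+ 2 <= x ^+ 2 by nra.
  by lra.
have h3 : d / 2 * x ^+ 2 <= 1 / 16 * (x * y) by nra.
have h4 : d / 2 * y ^+ 2 <= 3 / 5 * (x * y).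
  have yy : y ^+ 2 <= y by nra.
  by nra.
have h5 : 0 <= d / 2 * (2 * x ^+ 2 * y ^+ 2).
  by rewrite !mulr_ge0 ?exprn_ge0 //; lra.
have xy0 : 0 < x * y by apply: mulr_gt0; lra.
by lra.
Qed.
End Trigonometry.

(** * Comparison angles and first variation *)

Lemma le_of_sqr (R : realType) (u v : R) : 0 <= v -> u ^+ 2 <= v ^+ 2 -> u <= v.
Proof. by move=> v0 h; rewrite leNgt; apply/negP => lt; nra. Qed.

Section Metric.
Context {R : realType} {X : metricType R}.
Implicit Types (o x y z p q : X) (g : R -> X).

Lemma cmp_angle_range y x z : 0 < mdist x y -> 0 < mdist x z ->
  0 <= cmp_angle y x z <= pi /\
  2 * mdist x y * mdist x z * cos (cmp_angle y x z)
    = mdist x y ^+ 2 + mdist x z ^+ 2 - mdist y z ^+ 2.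
Proof.
move=> xy xz; rewrite /cmp_angle.
have := metric_triangle x y z; have := metric_triangle x z y.
have := metric_triangle y x z; rewrite (metric_sym y x) (metric_sym z y).
move: (mdist_ge0 y z) xy xz.
move: (mdist x y) (mdist x z) (mdist y z) => a b c c0 a0 b0 h1 h2 h3.
have ab : 0 < 2 * a * b by rewrite !mulr_gt0.
have [|/andP[-> ->] ->] :=
  @acos_def R ((a ^+ 2 + b ^+ 2 - c ^+ 2) / (2 * a * b)).
- rewrite ler_pdivlMr // ler_pdivrMr //; apply/andP; split; nra.
- by rewrite mulrC divfK // gt_eqF.
Qed.

Lemma geodesic_initial_segment {g} {t : R} :
  constant_speed_geodesic g -> 0 <= t <= 1 ->
  constant_speed_geodesic (fun s => g (t * s)) /\
  mdist (g (t * 0)) (g (t * 1)) = t * mdist (g 0) (g 1).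
Proof.
move=> hg /andP[t0 t1].
have E : mdist (g (t * 0)) (g (t * 1)) = t * mdist (g 0) (g 1).
  by rewrite hg ?mulr0 ?mulr1 ?lexx ?ler01 ?t0 // sub0r normrN ger0_norm.
split=> // s r /andP[s0 s1] /andP[r0 r1].
rewrite E hg ?mulr_ge0 ?mulr_ile1 //.
by rewrite -mulrBr normrM (ger0_norm t0); ring.
Qed.

(** The function |o g| is differentiable from the right at 0, and B is the
cosine of the angle that g makes with the direction of o. *)
Definition first_variation o g (B : R) : Prop :=
  -1 <= B <= 1 /\
  forall e : R, 0 < e -> exists2 t0 : R, 0 < t0 <= 1 &
    forall t : R, 0 < t <= t0 ->
      mdist o (g 0) - t * mdist (g 0) (g 1) * (B + e) <= mdist o (g t)
      <= mdist o (g 0) - t * mdist (g 0) (g 1) * (B - e).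

(** S-concavity on the initial segments of g says that the function G below is
nondecreasing. Its infimum I is its limit at 0 and determines B, and comparing
I with G 1 gives the last inequality. *)
Lemma first_variation_exists (S : R) o g : 1 <= S -> S_concave X S ->
  constant_speed_geodesic g ->
  0 < mdist (g 0) o -> 0 < mdist (g 0) (g 1) ->
  exists2 B, first_variation o g B &
    B <= cos (cmp_angle o (g 0) (g 1))
         + (S - 1) * mdist (g 0) (g 1) / (2 * mdist (g 0) o).
Proof.
move=> hS hX hg a0 c0.
have [_ cosE] := cmp_angle_range o (g 0) (g 1) a0 c0.
rewrite /first_variation (metric_sym o (g 0)).
set a := mdist (g 0) o in a0 cosE *; set c := mdist (g 0) (g 1) in c0 cosE *.
pose D t := mdist o (g t).
have D0 : D 0 = a by rewrite /D metric_sym.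
have Dg t : 0 <= t <= 1 -> mdist (g 0) (g t) = t * c.
  move=> /[dup] /andP[t0 t1] ht.
  by rewrite hg ?lexx ?ler01 // sub0r normrN ger0_norm.
have Dge0 t : 0 <= D t by exact: mdist_ge0.
have Dub t : 0 <= t <= 1 -> D t <= a + t * c.
  move=> ht; rewrite -D0 -Dg //; exact: metric_triangle.
have Dlb t : 0 <= t <= 1 -> a - t * c <= D t.
  move=> ht; have := metric_triangle o (g t) (g 0).
  by rewrite -/(D 0) D0 -/(D t) (metric_sym (g t)) Dg //; lra.
pose G t := (a ^+ 2 - D t ^+ 2) / t + S * t * c ^+ 2.
have GE t : 0 < t -> D t ^+ 2 = a ^+ 2 - t * (G t - S * t * c ^+ 2).
  by move=> t0; rewrite /G; field; rewrite gt_eqF.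
have Gmono s t : 0 < s <= t -> t <= 1 -> G s <= G t.
  move=> /andP[s0 st] t1; have t0 := lt_le_trans s0 st.
  have ht : 0 <= t <= 1 by lra.
  have [gt ct] := geodesic_initial_segment hg ht.
  have hst : 0 <= s / t <= 1.
    by rewrite divr_ge0 ?ler_pdivrMr ?mul1r // ltW.
  have := hX o _ (s / t) gt hst.
  rewrite ct mulr0 mulr1 (mulrC t (s / t)) divfK ?gt_eqF //.
  rewrite -/(D 0) -/(D t) -/(D s) D0 -/c !GE //.
  set r := s / t; have -> : s = r * t by rewrite /r divfK // gt_eqF.
  have r0 : 0 < r by apply: divr_gt0.
  move=> h; rewrite -(ler_pM2l (mulr_gt0 r0 t0)); lra.
have Glb t : 0 < t <= 1 -> - (2 * a * c) <= G t.
  move=> /andP[t0 t1]; rewrite -(ler_pM2l t0).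
  have ht : 0 <= t <= 1 by lra.
  have DD : D t ^+ 2 <= (a + t * c) ^+ 2.
    by have := Dub t ht; have := Dge0 t; nra.
  have : 0 <= (S - 1) * (t * c) ^+ 2 by rewrite mulr_ge0 ?exprn_ge0 //; nra.
  by move: DD; rewrite GE //; lra.
pose E := [set G t | t in [set t | 0 < t <= 1]].
have G1E : E (G 1) by exists 1 => //=; rewrite ltr01 lexx.
have infE : has_inf E.
  split; first by exists (G 1).
  by exists (- (2 * a * c)) => _ [t ht <-]; exact: Glb.
pose I := inf E.
have IG t : 0 < t <= 1 -> I <= G t.
  by move=> ht; apply: ge_inf; [exact: infE.2|exists t].
have ac : 0 < 2 * a * c by rewrite !mulr_gt0.
have Ilb : - (2 * a * c) <= I.
  by apply: lb_le_inf; [exists (G 1)|move=> _ [t ht <-]; exact: Glb].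
have Iub : I <= 2 * a * c.
  apply/ler_addgt0Pl => e e0.
  have Sc : 0 < S * c ^+ 2 by rewrite mulr_gt0 ?exprn_gt0 //; lra.
  pose t := Num.min 1 (Num.min (a / c) (e / (S * c ^+ 2))).
  have t0 : 0 < t by rewrite !lt_min ltr01 !divr_gt0.
  have : t <= t by []; rewrite {2}/t !le_min => /and3P[t1 ta te].
  rewrite ler_pdivlMr // in ta; rewrite ler_pdivlMr // in te.
  have ht : 0 <= t <= 1 by lra.
  have DD : (a - t * c) ^+ 2 <= D t ^+ 2.
    by have := Dlb t ht; have := Dge0 t; nra.
  apply: le_trans (IG t _) _; first by rewrite t0.
  rewrite -(ler_pM2l t0); rewrite GE // in DD.
  have : t * (t * (S * c ^+ 2)) <= t * e by rewrite ler_wpM2l // ltW.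
  have := sqr_ge0 (t * c); lra.
pose B := I / (2 * a * c).
have IE : I = 2 * a * c * B by rewrite /B mulrC divfK // gt_eqF.
have B1 : -1 <= B <= 1 by rewrite /B ler_pdivlMr // ler_pdivrMr //; lra.
exists B; last first.
  have := IG 1; rewrite ltr01 lexx => /(_ isT).
  rewrite /G divr1 mulr1 IE.
  have E1 : 2 * a * c * ((S - 1) * c / (2 * a)) = (S - 1) * c ^+ 2.
    by field; rewrite gt_eqF.
  move=> h; rewrite -(ler_pM2l ac) mulrDr E1; move: h.
  by move: cosE; rewrite -/(D 1); lra.
split=> // e e0.
have ace : 0 < a * c * e by rewrite !mulr_gt0.
have [_ [t1 /= /andP[t10 t11] <-] Gt1] := inf_adherent ace infE.
have ae : 0 < a * e by rewrite mulr_gt0.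
have Sc : 0 < S * c by apply: mulr_gt0; lra.
have ce : 0 < c * (1 + e) ^+ 2 by rewrite mulr_gt0 // exprn_gt0; lra.
(* The four bounds make G t close to I, the upper estimate of D t nonnegative,
   and the two second order terms in t negligible. *)
exists (Num.min t1 (Num.min (a / c)
         (Num.min (a * e / (S * c)) (a * e / (c * (1 + e) ^+ 2))))).
  by rewrite !lt_min !ge_min t10 t11 !divr_gt0.
move=> t; rewrite !le_min => /andP[t0 /and4P[tt1 ta tS te]].
rewrite ler_pdivlMr // in ta; rewrite ler_pdivlMr // in tS.
rewrite ler_pdivlMr // in te.
have ht : 0 < t <= 1 by lra.
have Gu : G t <= 2 * a * c * B + a * c * e.
  rewrite -IE ltW //; apply: le_lt_trans Gt1; apply: Gmono => //.
  by rewrite t0.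
have Gl : 2 * a * c * B <= G t by rewrite -IE; exact: IG.
rewrite -/(D t); set r := t * c.
have r0 : 0 < r by apply: mulr_gt0.
have Du : D t ^+ 2 <= a ^+ 2 - 2 * a * r * B + S * r ^+ 2.
  by rewrite GE // /r; have := ler_wpM2l (ltW t0) Gl; lra.
have Dl : a ^+ 2 - 2 * a * r * B - a * r * e <= D t ^+ 2.
  rewrite GE // /r; have := ler_wpM2l (ltW t0) Gu.
  have : 0 <= t * (S * t * c ^+ 2).
    by rewrite !mulr_ge0 ?exprn_ge0 //; lra.
  by lra.
have rS : S * r <= a * e by rewrite /r; lra.
have re : r * (1 + e) ^+ 2 <= a * e by rewrite /r; lra.
apply/andP; split; apply: le_of_sqr => //.
- apply: le_trans Dl.
  have : r * (r * (B + e) ^+ 2) <= r * (a * e).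
    rewrite ler_wpM2l ?(ltW r0) //; apply: le_trans re.
    rewrite ler_wpM2l ?(ltW r0) //; nra.
  by lra.
- have : r * (B - e) <= r * 1 by rewrite ler_wpM2l ?(ltW r0) //; lra.
  by rewrite /r; lra.
- apply: le_trans Du _.
  have : r * (S * r) <= r * (a * e) by rewrite ler_wpM2l // ltW.
  have := sqr_ge0 (r * (B - e)).
  have : 0 <= a * r * e by rewrite !mulr_ge0 // ltW.
  by lra.
Qed.

End Metric.

(** * The auxiliary observer *)

(** The straightness condition at x carries over to a nearby point m, at the
price of decreasing the factor by e. Here P and M stand for |pm| and |my|, and
U for |py|^2. *)
Lemma straightness_stable (R : realType) (S a b k e r P M U : R) :
  1 <= S -> 0 < a -> 0 < b ->
  0 <= k <= 1 -> 0 < r <= 1 -> 0 <= P <= a + r -> 0 <= M <= b + r ->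
  r * (2 * a + 2 * b + 2 + (2 * a + 1) + S * (2 * b + 1)) <= 2 * a * b * e ->
  2 * a * b * (k + e) <= U - a ^+ 2 - S * b ^+ 2 ->
  2 * P * k * M <= U - P ^+ 2 - S * M ^+ 2.
Proof.
move=> hS a0 b0 /andP[k0 k1] /andP[r0 r1] /andP[P0 Pa] /andP[M0 Mb] hr hU.
have P2 : P ^+ 2 <= (a + r) ^+ 2 by rewrite !expr2 ler_pM.
have M2 : S * M ^+ 2 <= S * (b + r) ^+ 2.
  by rewrite ler_wpM2l ?(le_trans ler01) // !expr2 ler_pM.
have PM : k * (P * M) <= k * ((a + r) * (b + r)) by rewrite ler_wpM2l // ler_pM.
have rr : r ^+ 2 <= r by rewrite expr2 ler_piMl // ltW.
have kk : k * (a * r + b * r + r ^+ 2) <= a * r + b * r + r ^+ 2.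
  by rewrite ler_piMl // !addr_ge0 ?mulr_ge0 ?sqr_ge0 ?ltW.
have Sr : S * r ^+ 2 <= S * r by rewrite ler_wpM2l ?(le_trans ler01).
by lra.
Qed.

(** S-concavity for an observer at distance L from the midpoint of a segment of
length L d, whose distances Q1 and Q2 to the ends are bounded below by first
order expansions. The corrections 3 d^3 only add an error of order d^3 to the
conclusion, which the term in d^2 absorbs. *)
Lemma observed_midpoint_bound (R : realType) (S d B C L Q1 Q2 : R) :
  0 < d <= 1 / 8 -> -1 <= B <= 1 -> -1 <= C <= 1 -> 0 < L ->
  L - L * d / 2 * (B + 3 * d ^+ 3) <= Q1 ->
  L - L * d / 2 * (C + 3 * d ^+ 3) <= Q2 ->
  Q1 ^+ 2 / 2 + Q2 ^+ 2 / 2 - S / 4 * (L * d) ^+ 2 <= L ^+ 2 ->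
  - (B + C) <= 4 / 5 * d ^+ 2 + d / 2 * (S - (B ^+ 2 + C ^+ 2) / 2).
Proof.
move=> /andP[d0 d8] /andP[B0 B1] /andP[C0 C1] L0 h1 h2 h.
have d2 : d ^+ 2 <= 1 / 64 by nra.
have dd : 0 <= 3 * d ^+ 3 <= 3 / 8 * d ^+ 2.
  rewrite mulr_ge0 ?exprn_ge0 ?(ltW d0) //= (exprS d 2).
  by have := sqr_ge0 d; nra.
set D := 3 * d ^+ 3 in dd h1 h2.
have D1 : D <= 1 by lra.
have sq (A Q : R) : -1 <= A <= 1 -> L - L * d / 2 * (A + D) <= Q ->
    L ^+ 2 * (1 - d * (A + D) + d ^+ 2 / 4 * (A + D) ^+ 2) <= Q ^+ 2.
  move=> hA hQ.
  have -> : L ^+ 2 * (1 - d * (A + D) + d ^+ 2 / 4 * (A + D) ^+ 2)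
      = (L - L * d / 2 * (A + D)) ^+ 2 by field.
  have F0 : 0 <= L - L * d / 2 * (A + D).
    have : d * (A + D) <= 1 by nra.
    by move/(ler_wpM2l (ltW L0)); lra.
  by rewrite !expr2 ler_pM.
have := sq B Q1 ltac:(lra) h1; have := sq C Q2 ltac:(lra) h2.
move=> s2 s1.
have L2 : 0 < L ^+ 2 by rewrite exprn_gt0.
have key : (1 - d * (B + D) + d ^+ 2 / 4 * (B + D) ^+ 2)
    + (1 - d * (C + D) + d ^+ 2 / 4 * (C + D) ^+ 2) <= 2 + S / 2 * d ^+ 2.
  by rewrite -(ler_pM2l L2); lra.
have sqlb (A : R) : -1 <= A -> A ^+ 2 - 2 * D <= (A + D) ^+ 2.
  by move=> hA; case/andP: dd => D0 _; nra.
have kB := ler_wpM2l (sqr_ge0 d) (sqlb B B0).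
have kC := ler_wpM2l (sqr_ge0 d) (sqlb C C0).
rewrite -(ler_pM2l d0).
have : d * (2 * D + d * D) <= d * (4 / 5 * d ^+ 2).
  rewrite ler_wpM2l ?(ltW d0) //; have := sqr_ge0 d.
  have : d * D <= 1 / 8 * D by rewrite ler_wpM2r //; lra.
  by lra.
by lra.
Qed.

Section Observer.
Context {R : realType} {X : metricType R}.
Implicit Types (o x y z p q : X) (g : R -> X).

(** The hypothesis says that the comparison angle of p, m, y is so close to pi
that the path from p through m to y is straight up to a factor k. Concavity of
|p.| along a geodesic from m to y propagates this to the points q close to m,
whatever the scale l. *)
Lemma almost_straight_extension (S k : R) p m y : geodesic_space X ->
  S_concave X S -> 1 <= S -> 0 <= k <= 1 ->
  2 * mdist p m * k * mdist m y
    <= mdist p y ^+ 2 - mdist p m ^+ 2 - S * mdist m y ^+ 2 ->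
  forall l : R, 0 < l <= mdist m y -> exists q,
    [/\ mdist m q = l, mdist q y = mdist m y - l &
        mdist p m + l * k <= mdist p q].
Proof.
move=> hgeo hX hS hk h l /andP[l0 lM].
have [g [hg g0 g1]] := hgeo m y.
have M0 := lt_le_trans l0 lM.
pose s := l / mdist m y.
have sM : s * mdist m y = l by rewrite /s divfK // gt_eqF.
have hs : 0 <= s <= 1 by rewrite /s divr_ge0 ?ler_pdivrMr ?mul1r // ltW.
have E0 : mdist m (g s) = l.
  rewrite -{1}g0 hg ?lexx ?ler01 // g0 g1 sub0r normrN ger0_norm ?sM //.
  by case/andP: hs.
have E1 : mdist (g s) y = mdist m y - l.
  rewrite -{1}g1 hg ?lexx ?ler01 // g0 g1 distrC ger0_norm; last by lra.
  by rewrite mulrBl mul1r sM.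
exists (g s); split => //.
have := hX p g s hg hs; rewrite g0 g1.
clear E0 E1; clearbody s; move: (mdist_ge0 p (g s)) (mdist_ge0 p m) hs sM M0 h.
move: (mdist p (g s)) (mdist p m) (mdist p y) (mdist m y) lM => Q P u M lM.
move=> Q0 P0 /andP[s0 s1] sM M0 h hc; apply: le_of_sqr => //.
apply: le_trans hc.
have h1 := ler_wpM2l s0 h.
have k2 : k ^+ 2 <= 1 by case/andP: hk => *; rewrite expr_le1.
have h2 : (l * k) ^+ 2 <= S * l ^+ 2.
  rewrite exprMn mulrC ler_wpM2r ?sqr_ge0 //; lra.
by rewrite -sM in h2 *; lra.
Qed.

(** The hypothesis on |py| is what remains of the assumption that the
comparison angle of p, x, y is almost pi and that |xy| is small compared with
|px|. The point x is g 0. *)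
Lemma first_variation_sum (S d B C : R) p y g : geodesic_space X ->
  S_concave X S -> 1 <= S -> 0 < d <= 1 / 8 ->
  constant_speed_geodesic g -> 0 < mdist (g 0) (g 1) ->
  0 < mdist (g 0) p -> 0 < mdist (g 0) y ->
  2 * mdist (g 0) p * mdist (g 0) y * (1 - d ^+ 4)
    <= mdist p y ^+ 2 - mdist (g 0) p ^+ 2 - S * mdist (g 0) y ^+ 2 ->
  first_variation p g B -> first_variation y g C ->
  - (B + C) <= 4 / 5 * d ^+ 2 + d / 2 * (S - (B ^+ 2 + C ^+ 2) / 2).
Proof.
move=> hgeo hX hS /andP[d0 d8] hg c0 a0 b0 hu [B1 hB] [C1 hC].
rewrite (metric_sym p) in hB; rewrite (metric_sym y) in hC.
set x := g 0 in c0 a0 b0 hu hB hC.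
set a := mdist x p in a0 hu hB; set b := mdist x y in b0 hu hC.
set c := mdist x (g 1) in c0 hB hC; set u := mdist p y in hu.
(* In the lower bound of |qx| below, the first variation errors enter as e and
   the straightness error as 2 (d^4 + e) / d; the sum has to stay below
   3 d^3. *)
pose e := d ^+ 4 / 4.
have e0 : 0 < e by rewrite divr_gt0 ?exprn_gt0.
have [tB /andP[tB0 tB1] {}hB] := hB e e0.
have [tC /andP[tC0 tC1] {}hC] := hC e e0.
pose K := 2 * a + 2 * b + 2 + (2 * a + 1) + S * (2 * b + 1).
have K0 : 0 < K.
  have : 0 < S * (2 * b + 1) by apply: mulr_gt0; lra.
  by rewrite /K; lra.
have abe : 0 < 2 * a * b * e by rewrite !mulr_gt0.
have V0 : 0 < 1 + d^-1 by rewrite addr_gt0 ?invr_gt0.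
(* The last three bounds ensure r <= 1, the smallness of r required by
   [straightness_stable], and L <= |my|. *)
pose t := Num.min tB (Num.min tC (Num.min (1 / c)
  (Num.min (2 * a * b * e / K / c) (b / (1 + d^-1) / c)))).
have t0 : 0 < t by rewrite !lt_min tB0 tC0 !divr_gt0.
have : t <= t by []; rewrite {2}/t !le_min => /and5P[ttB ttC].
rewrite !ler_pdivlMr // => tc1 tcK tcV.
clearbody t; set r := t * c in tc1 tcK tcV.
have r0 : 0 < r by apply: mulr_gt0.
pose m := g (t * (1 / 2)); pose z := g t.
have ht : 0 <= t <= 1 by lra.
have [hgt Egt] := geodesic_initial_segment hg ht.
have tt : 0 < t * (1 / 2) <= tB /\ 0 < t * (1 / 2) <= tC by lra.
have /andP[Bm _] := hB _ tt.1.
have /andP[_ Cm] := hC _ tt.2.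
have /andP[Cz _] := hC t ltac:(lra).
have th : t * (1 / 2) * c = r / 2 by rewrite /r; ring.
rewrite th -/m in Bm; rewrite th -/m in Cm; rewrite -/r -/z in Cz.
have xm : mdist x m = r / 2.
  rewrite /x /m hg ?lexx ?ler01 //; last by lra.
  by rewrite sub0r normrN ger0_norm -/x -/c /r; [ring|lra].
have Pub : mdist p m <= a + r / 2.
  by rewrite -xm /a (metric_sym x p); exact: metric_triangle.
have Plb : a - r / 2 <= mdist p m.
  rewrite -xm (metric_sym x m) (metric_sym p).
  by have := metric_triangle x m p; rewrite -/a (metric_sym x m); lra.
have Mub : mdist m y <= b + r / 2.
  by rewrite -xm (metric_sym x m) addrC; exact: metric_triangle.
have Mlb : b - r / 2 <= mdist m y.
  by rewrite -xm; have := metric_triangle x m y; rewrite -/b; lra.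
have /andP[d40 d41] : 0 < d ^+ 4 <= 1 / 64.
  rewrite exprn_gt0 //=; have : d ^+ 2 <= 1 / 64 by nra.
  by rewrite (_ : d ^+ 4 = (d ^+ 2) ^+ 2); [have := sqr_ge0 d; nra|ring].
pose k := 1 - d ^+ 4 - e.
have hk : 0 <= k <= 1 by rewrite /k /e; lra.
have hPM : 2 * mdist p m * k * mdist m y
    <= u ^+ 2 - mdist p m ^+ 2 - S * mdist m y ^+ 2.
  apply: (@straightness_stable _ S a b k e r) => //;
    rewrite ?mdist_ge0 //; try lra.
  by rewrite /k subrK.
pose L := r / d.
have L0 : 0 < L by apply: divr_gt0.
have rL : r = L * d by rewrite /L divfK // gt_eqF.
have LM : 0 < L <= mdist m y.
  rewrite L0 /=; apply: le_trans Mlb; rewrite /L; lra.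
have [q [mq qy hq]] :=
  almost_straight_extension S k p m y hgeo hX hS hk hPM L LM.
have X1 : L - r / 2 * (B + 3 * d ^+ 3) <= mdist q x.
  have := metric_triangle p x q; rewrite (metric_sym p x) -/a (metric_sym x q).
  have := mulr_gt0 L0 d40.
  have re : r * e <= L * (d ^+ 4 / 32).
    by rewrite rL -mulrA ler_wpM2l ?(ltW L0) // /e; nra.
  have rd : r * d ^+ 3 = L * d ^+ 4 by rewrite rL; ring.
  have Le : L * e = L * d ^+ 4 / 4 by rewrite /e mulrA.
  by rewrite /k in hq; lra.
have X2 : L - r / 2 * (C + 3 * d ^+ 3) <= mdist q z.
  have := metric_triangle y q z; rewrite (metric_sym y q) qy.
  have re : 3 * r * e <= r * d ^+ 3.
    rewrite -mulrA mulrCA ler_wpM2l ?(ltW r0) //.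
    by rewrite /e; have := exprn_gt0 3 d0; rewrite (exprSr d 3); nra.
  have rd : 0 < r * d ^+ 3 by rewrite mulr_gt0 // exprn_gt0.
  by rewrite (metric_sym m y); lra.
have := hX q _ (1 / 2) hgt; rewrite Egt mulr0 mulr1 -/x -/z -/m -/c -/r.
rewrite (metric_sym q m) mq => /(_ ltac:(lra)).
rewrite rL in X1 X2 *.
move=> h.
by apply: (observed_midpoint_bound _ _ _ _ _ _ _ _ _ B1 C1 L0 X1 X2); lra.
Qed.

End Observer.

(** * The quadruple inequality *)

Lemma err_le_cos (R : realType) (S s t d : R) : d <= pi -> err_le S s t d ->
  [/\ 0 < s, 0 < t & (S - 1) * s / (2 * t) <= 1 - cos d].
Proof.
move=> dpi [s0 t0 ran hd]; split => //.
have := ler_cos (err S s t) d (acos_ge0 ran) hd dpi.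
by rewrite /err acosK ?in_itv // /err_arg; lra.
Qed.

(** The bound with 2 delta instead of 14 delta: a loss of delta when passing
from each of the angles at x opposite to pz and yz to its first variation
angle. *)
Lemma quadruple_angle_sum (R : realType) (X : metricType R) (S delta : R)
    (x p y z : X) : 1 <= S -> S_concave_space X S -> 0 < delta <= 1 / 64 ->
  4 * (S - 1) * Num.sqrt delta <= 1 -> quadruple_hyp S delta x p y z ->
  cmp_angle p x y + cmp_angle p x z + cmp_angle y x z
  <= 2 * pi + acos (1 - 4 * (S - 1) * Num.sqrt delta)
     + 2 * delta + 2 * Num.sqrt delta.
Proof.
move=> hS [_ _ hgeo hX] /andP[dl0 dl1] hSd [_ hal /andP[zy yp] e1 e2].
have pi2 := @pi_ge2 R.
have dlpi : delta <= pi by lra.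
set d := Num.sqrt delta in hSd *.
have d0 : 0 < d by rewrite sqrtr_gt0.
have d2 : delta = d ^+ 2 by rewrite sqr_sqrtr // ltW.
have d8 : d <= 1 / 8 by rewrite d2 in dl1; nra.
have [c0 b0 hc] := err_le_cos _ _ _ _ _ dlpi e1.
have [_ a0 hb] := err_le_cos _ _ _ _ _ dlpi e2.
rewrite (metric_sym p x) in yp a0 hb.
have [g [hg g0 g1]] := hgeo x z.
have [ra ca] := cmp_angle_range p x y a0 b0.
have [rb cb] := cmp_angle_range p x z a0 c0.
have [rc cc] := cmp_angle_range y x z b0 c0.
have cosd : 1 - d ^+ 4 / 2 <= cos delta.
  have := @cos_quadratic_ge R delta ltac:(lra).
  by rewrite {1}d2 -exprM.
have cosal : cos (cmp_angle p x y) <= - cos delta.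
  have -> : - cos delta = cos (pi - delta) by rewrite cosB cospi sinpi; ring.
  by apply: ler_cos => //; [lra|case/andP: ra].
have c0' : 0 < mdist (g 0) (g 1) by rewrite g0 g1.
have a0' : 0 < mdist (g 0) p by rewrite g0.
have b0' : 0 < mdist (g 0) y by rewrite g0.
have [B hB lB] := first_variation_exists S p g hS hX hg a0' c0'.
have [C hC lC] := first_variation_exists S y g hS hX hg b0' c0'.
have hu : 2 * mdist (g 0) p * mdist (g 0) y * (1 - d ^+ 4)
    <= mdist p y ^+ 2 - mdist (g 0) p ^+ 2 - S * mdist (g 0) y ^+ 2.
  rewrite g0; set a := mdist x p in a0 ca hb *.
  set b := mdist x y in b0 ca hb *.
  have ab : 0 < 2 * a * b by rewrite !mulr_gt0.
  rewrite ler_pdivrMr in hb; last by rewrite mulr_gt0.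
  have h1 := ler_wpM2l (ltW b0) hb.
  have h2 := ler_wpM2l (ltW ab) cosal.
  have h3 := ler_wpM2l (ltW ab) cosd.
  by lra.
have := first_variation_sum S d B C p y g hgeo hX hS _ hg c0' a0' b0' hu hB hC.
rewrite d0 d8 => /(_ isT) hBC.
case: hB => hB _; case: hC => hC _.
rewrite -(acosK (x := B)) ?in_itv // -(acosK (x := C)) ?in_itv // in hBC.
have := angle_sum_of_cos_sum S d _ _ hS _ hSd _ _ hBC.
rewrite d0 d8 !acos_ge0 ?acos_lepi // => /(_ isT isT isT) hsum.
have hdpi : 0 <= delta <= pi by rewrite ltW.
have hac : (S - 1) * mdist x z / (2 * mdist x p) <= 1 - cos delta.
  apply: le_trans hc; rewrite ler_wpM2l //.
    by apply: mulr_ge0; [lra|exact: ltW].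
  by rewrite lef_pV2 ?posrE ?mulr_gt0 // ler_pM2l.
rewrite g0 g1 in lB lC.
have bB : cmp_angle p x z <= acos B + delta.
  apply: le_angle_of_cos => //; first by rewrite acos_ge0 ?acos_lepi.
  by rewrite acosK ?in_itv //; lra.
have bC : cmp_angle y x z <= acos C + delta.
  apply: le_angle_of_cos => //; first by rewrite acos_ge0 ?acos_lepi.
  by rewrite acosK ?in_itv //; lra.
by lra.
Qed.

Lemma error_bound_small (R : realType) (S eps : R) : 1 <= S -> 0 < eps <= pi ->
  exists2 delta_bar : R, 0 < delta_bar &
    forall delta : R, 0 < delta <= delta_bar ->
      [/\ delta <= 1 / 64, 4 * (S - 1) * Num.sqrt delta <= 1 &
          acos (1 - 4 * (S - 1) * Num.sqrt delta)
            + 14 * delta + 2 * Num.sqrt delta <= eps].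
Proof.
move=> hS /andP[e0 epi]; have pi2 := @pi_ge2 R.
have c1 : cos (eps / 2) < 1.
  by rewrite -[X in _ < X]cos0 ltr_cos ?in_itv /=; lra.
have c0 : 0 <= cos (eps / 2) by apply: cos_ge0_pihalf; lra.
pose D := Num.min (1 / 8) (Num.min (eps / 8) ((1 - cos (eps / 2)) / (4 * S))).
have D0 : 0 < D by rewrite !lt_min !divr_gt0 //; lra.
exists (D ^+ 2); first exact: exprn_gt0.
move=> delta /andP[dl0].
rewrite -(ler_sqrt _ (sqr_ge0 D)) sqrtr_sqr gtr0_norm //.
have d2 : delta = Num.sqrt delta ^+ 2 by rewrite sqr_sqrtr // ltW.
have d0 : 0 < Num.sqrt delta by rewrite sqrtr_gt0.
move: (Num.sqrt delta) d2 d0 => d -> d0.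
rewrite !le_min => /and3P[d8 de]; rewrite ler_pdivlMr => [dS|]; last by lra.
have S0 : 0 <= (S - 1) * d by apply: mulr_ge0; lra.
have ran : -1 <= 1 - 4 * (S - 1) * d <= 1 by lra.
have A : acos (1 - 4 * (S - 1) * d) <= eps / 2.
  rewrite leNgt; apply/negP => lt.
  have : cos (acos (1 - 4 * (S - 1) * d)) < cos (eps / 2).
    by rewrite ltr_cos // in_itv /= ?acos_ge0 ?acos_lepi //; lra.
  by rewrite acosK ?in_itv //; lra.
have dd : d ^+ 2 <= 1 / 8 * d by rewrite expr2 ler_wpM2r // ltW.
by split; lra.
Qed.

Theorem proposition3p7 (R : realType) (S : R) (hS : 1 <= S) :
  (forall (X : metricType R) (delta : R),
     S_concave_space X S ->
     0 < delta <= 1 / 64 ->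
     4 * (S - 1) * Num.sqrt delta <= 1 ->
     forall x p y z : X, quadruple_hyp S delta x p y z ->
       cmp_angle p x y + cmp_angle p x z + cmp_angle y x z
         <= 2 * pi + acos (1 - 4 * (S - 1) * Num.sqrt delta)
            + 14 * delta + 2 * Num.sqrt delta)
  /\
  (forall eps : R, 0 < eps <= pi ->
     exists delta_bar : R, 0 < delta_bar /\
       forall X : metricType R, S_concave_space X S ->
         forall delta : R, 0 < delta <= delta_bar ->
           weak_quadruple_condition X S eps delta).
Proof.
have bound (X : metricType R) (delta : R) : S_concave_space X S ->
    0 < delta <= 1 / 64 -> 4 * (S - 1) * Num.sqrt delta <= 1 ->
    forall x p y z : X, quadruple_hyp S delta x p y z ->
      cmp_angle p x y + cmp_angle p x z + cmp_angle y x z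
        <= 2 * pi + acos (1 - 4 * (S - 1) * Num.sqrt delta)
           + 14 * delta + 2 * Num.sqrt delta.
  move=> hX hd hSd x p y z hq.
  apply: le_trans (quadruple_angle_sum R X S delta x p y z hS hX hd hSd hq) _.
  by lra.
split=> // eps heps.
have [D D0 hD] := error_bound_small R S eps hS heps.
exists D; split=> // X hX delta hd; have [d1 d2 d3] := hD _ hd.
have pi2 := @pi_ge2 R.
split; [lra|lra|move=> x p y z hq].
by apply: le_trans (bound X delta hX _ d2 x p y z hq) _; lra.
Qed.
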